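(* Let $V$ be a finite set and $g \colon 2^V \to \mathbb{R}$ an arbitrary set function. Then for $T \subseteq V$, the function $h(X) = g(X \vartriangle T)$ is submodular if and only if $M_g \boldsymbol{\chi}_T \equiv \mathbf{b}_g \pmod 2$, where $\boldsymbol{\chi}_T$ is the characteristic vector of $T$.
   Context: A set function on $2^V$ is submodular if $h(X)+h(Y) \ge h(X \cup Y) + h(X \cap Y)$ for all $X,Y \subseteq V$. $X \vartriangle T$ is the symmetric difference. $\mathcal{P} = \{ (Z,\{u,v\}) : Z \subseteq V,\ u,v \in V \setminus Z,\ u \ne v\}$, and $\check{\Phi}_g(Z,\{u,v\}) = g(Z \cup \{u\}) + g(Z \cup \{v\}) - g(Z \cup \{u,v\}) - g(Z)$. $M_g$ is the $0$-$1$ matrix with rows indexed by $\mathcal{P}$ and columns by $V$ whose $(Z,\{u,v\})$-row is the characteristic row vector of $\{u,v\}$ if $\check{\Phi}_g(Z,\{u,v\}) \neq 0$ and zero otherwise. $\mathbf{b}_g \in \{0,1\}^{\mathcal{P}}$ has $\mathbf{b}_g[(Z,\{u,v\})] = 0$ if $\check{\Phi}_g(Z,\{u,v\}) \ge 0$ and $1$ otherwise. *)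

(* Defs.v *)
From mathcomp Require Import all_boot all_order all_algebra.
From mathcomp Require Import reals.

Set Implicit Arguments.
Unset Strict Implicit.
Unset Printing Implicit Defensive.

Import Order.TTheory GRing.Theory Num.Theory.
Local Open Scope ring_scope.

Definition submodular (R : realType) (V : finType) (h : {set V} -> R) : Prop :=
  forall X Y : {set V}, h X + h Y >= h (X :|: Y) + h (X :&: Y).

Definition symdiff (V : finType) (X T : {set V}) : {set V} :=
  (X :\: T) :|: (T :\: X).

Definition Pairs (V : finType) : {set {set V} * {set V}} :=
  [set p : {set V} * {set V} | [exists u : V, exists v : V,
    [&& u \notin p.1, v \notin p.1, u != v & p.2 == [set u; v]]]].

(* The unordered pair {u, v} is the second component of p, so g(Z + u) + g(Z + v)
   is written as a sum over its elements; see Phi_pair. *)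
Definition Phi (R : realType) (V : finType) (g : {set V} -> R)
    (p : {set V} * {set V}) : R :=
  \sum_(w in p.2) g (p.1 :|: [set w]) - g (p.1 :|: p.2) - g p.1.

Lemma Phi_pair (R : realType) (V : finType) (g : {set V} -> R)
    (Z : {set V}) (u v : V) : u != v ->
  Phi g (Z, [set u; v]) =
  g (Z :|: [set u]) + g (Z :|: [set v]) - g (Z :|: [set u; v]) - g Z.
Proof. by move=> uv; rewrite /Phi /= big_setU1 ?inE //= big_set1. Qed.

(* Rows are numbered by enum_val on Pairs V and columns by enum_val on V. *)
Definition Mmx (R : realType) (V : finType) (g : {set V} -> R) :
    'M[int]_(#|Pairs V|, #|V|) :=
  \matrix_(i, j)
    (if Phi g (enum_val i) != 0 then ((enum_val j \in (enum_val i).2) : nat)%:Z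
     else 0).

Definition bvec (R : realType) (V : finType) (g : {set V} -> R) :
    'cV[int]_#|Pairs V| :=
  \col_i (if Phi g (enum_val i) >= 0 then 0 else 1).

Definition chi (V : finType) (T : {set V}) : 'cV[int]_#|V| :=
  \col_j ((enum_val j \in T) : nat)%:Z.

Definition eq_mod2 (n : nat) (x y : 'cV[int]_n) : Prop :=
  forall i : 'I_n, (x i ord0 = y i ord0 %[mod 2])%Z.

(* Main.v *)
(** Submodularity is a local condition: it suffices that
    [h (Z + u) + h (Z + v) >= h (Z + u + v) + h Z] for all [u != v] outside [Z].
    Translating by [T] permutes the four vertices of such a square of the cube
    [2^V], exchanging the two diagonals exactly when one of [u], [v] lies in
    [T]; so the second difference of [h] is that of [g] on the translated
    square, up to the sign [(-1) ^ #|[set u; v] :&: T|].  Nonnegativity of all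
    the signed differences is what the equations modulo 2 express. *)
Require Import Defs.
From mathcomp Require Import all_boot all_order all_algebra.
From mathcomp Require Import reals zify ring lra.

Import Order.TTheory GRing.Theory Num.Theory.
Local Open Scope ring_scope.

(** Squares stack: adding the inequalities of two adjacent squares cancels their common side. Any
    [X], [Y] are thus reached from the base [X :&: Y] by adding [X :\: Y] and [Y :\: X] one element
    at a time. *)
Lemma submodular_local (R : realType) (V : finType) (h : {set V} -> R) :
  submodular h <->
  forall (Z : {set V}) (u v : V), u \notin Z -> v \notin Z -> u != v ->
    0 <= Phi h (Z, [set u; v]).
Proof.
split=> [sub_h Z u v uZ vZ uv | loc_h X Y].
  have := sub_h (Z :|: [set u]) (Z :|: [set v]).
  rewrite -setUIr setUACA setUid Phi_pair //.
  have -> : [set u] :&: [set v] = set0.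
    by apply/setP=> x; rewrite !inE; apply/negP=> /andP[/eqP-> /eqP/eqP]; apply/negP.
  rewrite setU0; lra.
pose F A C D := h (A :|: C :|: D) + h A <= h (A :|: C) + h (A :|: D).
have FC A C D : F A C D -> F A D C.
  by rewrite /F setUAC addrC [leRHS]addrC [leLHS]addrC.
(* In the sum of the two inequalities, the values of [h] at [A :|: D] and [A :|: C :|: D] cancel. *)
have FU A C D E : F A C D -> F (A :|: D) C E -> F A C (E :|: D).
  rewrite /F (setUC E) !setUA (setUAC A D C); lra.
have F0 A C : F A C set0 by rewrite /F !setU0.
have F11 A u v : u != v -> F A [set u] [set v].
  move=> uv; rewrite /F.
  (* [Fset] below asks for every base, including those that contain [u] or [v]; there the square
     degenerates and equality holds. *)
  have [uA|uA] := boolP (u \in A).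
    have -> : A :|: [set u] = A by apply/setUidPl; rewrite sub1set.
    lra.
  have [vA|vA] := boolP (v \in A).
    have -> : A :|: [set u] :|: [set v] = A :|: [set u].
      by apply/setUidPl; rewrite sub1set inE vA.
    have -> // : A :|: [set v] = A by apply/setUidPl; rewrite sub1set.
  have := loc_h A u v uA vA uv; rewrite Phi_pair // setUA; lra.
have Fset (A C D : {set V}) : (forall x B, x \in D -> F B C [set x]) -> F A C D.
  elim: {D}#|D| {-2}D (erefl #|D|) => [|n IHn] D cD FD.
    by rewrite (cards0_eq cD); apply: F0.
  have [x xD] : exists x, x \in D by apply/card_gt0P; rewrite cD.
  rewrite -(setD1K xD); apply: FU; last exact: FD.
  apply: IHn => [|y B /setD1P[_ yD]]; last exact: FD.
  by move: cD; rewrite (cardsD1 x) xD => -[].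
have: F (X :&: Y) (X :\: Y) (Y :\: X).
  (* [Fset] splits only its last argument, so [FC] swaps the two sides between its uses. *)
  apply: (Fset) => y B /setDP[yY _]; apply: FC; apply: Fset => x B' /setDP[_ xY].
  by apply: F11; apply: contraNneq xY => <-.
by rewrite /F setID (setIC X Y) setID setDE setUIr setUCr setIT.
Qed.

Lemma Phi_symdiff (R : realType) (V : finType) (g : {set V} -> R)
    (T Z : {set V}) (u v : V) : u \notin Z -> v \notin Z -> u != v ->
  Phi (fun X => g (symdiff X T)) (Z, [set u; v]) =
  (-1) ^+ #|[set u; v] :&: T| * Phi g (symdiff Z T :\: [set u; v], [set u; v]).
Proof.
move=> uZ vZ uv; rewrite !Phi_pair //.
set W := symdiff Z T :\: _.
(* Outside [[set u; v]] all four translated vertices agree with [W]; inside, only the trace of [T]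
   acts, which leaves four cases. *)
have square (S : {set V}) : S \subset [set u; v] ->
    symdiff (Z :|: S) T = W :|: symdiff S ([set u; v] :&: T).
  move=> /subsetP sS; apply/setP=> x; rewrite !inE.
  have := sS x; rewrite !inE.
  have [->|xu] := eqVneq x u; first by rewrite (negPf uZ); do 2 case: (_ \in _).
  have [->|xv] := eqVneq x v; first by rewrite (negPf vZ); do 2 case: (_ \in _).
  by case: (x \in S) => [/(_ isT) //|_]; rewrite ?orbF ?andbF ?andbT ?orbF.
have vu : v == u = false by rewrite eq_sym (negPf uv).
(* The fourth [Z] is the bare vertex; as [Z :|: set0] it also matches [square]. *)
rewrite -{4}(setU0 Z) !square ?sub0set ?subsetUl ?subsetUr //.
have -> : [set u; v] :&: T =
    (if u \in T then [set u] else set0) :|: (if v \in T then [set v] else set0).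
  apply/setP=> x; rewrite !inE.
  have [->|xu] := eqVneq x u; last have [->|xv] := eqVneq x v.
  - by rewrite (negPf uv) /=; case: (u \in T); case: (v \in T);
      rewrite !inE ?eqxx ?(negPf uv).
  - by rewrite /=; case: (u \in T); case: (v \in T); rewrite !inE ?eqxx ?vu.
  - by case: (u \in T); case: (v \in T); rewrite !inE ?(negPf xu) ?(negPf xv).
have sd0 (S : {set V}) : symdiff S set0 = S by rewrite /symdiff setD0 set0D setU0.
have sd0l (S : {set V}) : symdiff set0 S = S by rewrite /symdiff setD0 set0D set0U.
have sdS (S : {set V}) : symdiff S S = set0 by rewrite /symdiff setDv setU0.
have uDv : [set u] :\: [set v] = [set u].
  by apply/setDidPl; rewrite disjoints1 inE.
have vDu : [set v] :\: [set u] = [set v].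
  by apply/setDidPl; rewrite disjoints1 inE vu.
have sd_u_v : symdiff [set u] [set v] = [set u; v] by rewrite /symdiff uDv vDu.
have sd_v_u : symdiff [set v] [set u] = [set u; v] by rewrite /symdiff uDv vDu setUC.
have sd_uv_u : symdiff [set u; v] [set u] = [set v].
  by rewrite /symdiff setDUl setDv vDu set0U setDUr setDv set0I setU0.
have sd_uv_v : symdiff [set u; v] [set v] = [set u].
  by rewrite /symdiff setDUl setDv uDv setU0 setDUr setDv setI0 setU0.
have sd_u_uv : symdiff [set u] [set u; v] = [set v].
  by rewrite /symdiff setUC -/(symdiff _ _) sd_uv_u.
have sd_v_uv : symdiff [set v] [set u; v] = [set u].
  by rewrite /symdiff setUC -/(symdiff _ _) sd_uv_v.
case: (u \in T); case: (v \in T);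
  rewrite ?setU0 ?set0U ?cards2 ?cards1 ?cards0 ?uv ?sd0 ?sd0l ?sdS
    ?sd_u_v ?sd_v_u ?sd_uv_u ?sd_uv_v ?sd_u_uv ?sd_v_uv ?setU0; ring.
Qed.

(** A nonzero row selects the columns of its pair, so the product yields the exponent of the sign in
    [Phi_symdiff]. *)
Lemma mulmx_Mmx_chi (R : realType) (V : finType) (g : {set V} -> R)
    (T : {set V}) (i : 'I_#|Pairs V|) :
  (Mmx g *m chi T) i ord0 =
  if Phi g (enum_val i) != 0 then #|(enum_val i).2 :&: T|%:Z else 0.
Proof.
rewrite mxE.
case: ifP => PhiE; last by rewrite big1 // => j _; rewrite !mxE PhiE mul0r.
under eq_bigr do rewrite !mxE PhiE.
rewrite -(big_enum_val (A := V) (fun x => (x \in _)%:Z * (x \in T)%:Z)) /=.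
rewrite -sum1_card [in RHS]big_mkcond /= (big_morph _ PoszD (erefl _)).
by apply: eq_bigr => x _; rewrite inE; do 2 case: (_ \in _).
Qed.

(** For [a = 0] both sides hold trivially; otherwise the congruence says that [k] is odd exactly
    when [a] is negative. *)
Lemma mod2_sign (R : realType) (k : nat) (a : R) :
  ((if (a != 0)%R then k%:Z else 0) = (if (0 <= a)%R then 0 else 1) %[mod 2])%Z <->
  0 <= (-1) ^+ k * a.
Proof.
rewrite -signr_odd.
have odd_mod (e : bool) : (k%:Z = e%:Z %[mod 2])%Z <-> odd k = e by lia.
have [->|a0] := eqVneq a 0; first by rewrite lexx mulr0.
case: (leP 0 a) => ha; [rewrite (odd_mod false) | rewrite (odd_mod true)];
  case: (odd k); rewrite ?expr1 ?expr0 ?mul1r ?mulN1r ?oppr_ge0; split=> //.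
- by move=> ha'; rewrite (le_anti (introT andP (conj ha' ha))) eqxx in a0.
- by move=> _; apply: ltW.
- by rewrite leNgt ha.
Qed.

Theorem theorem4p5 (R : realType) (V : finType) (g : {set V} -> R)
    (T : {set V}) :
  submodular (fun X : {set V} => g (symdiff X T)) <->
  eq_mod2 (Mmx g *m chi T) (bvec g).
Proof.
rewrite submodular_local; split=> [loc_h i | eq2 Z u v uZ vZ uv].
  rewrite mulmx_Mmx_chi mxE; apply/mod2_sign.
  have := enum_valP i; move: (enum_val i) => [W P]; rewrite inE /=.
  case/existsP=> u /existsP[v /and4P[uW vW uv /eqP->]].
  (* Outside [[set u; v]] translation by [T] is an involution, so this base is carried back to
     [W]. *)
  have := loc_h (symdiff W T :\: [set u; v]) u v.
  rewrite Phi_symdiff ?inE ?eqxx ?orbT //.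
  have -> : symdiff (symdiff W T :\: [set u; v]) T :\: [set u; v] = W.
    apply/setP=> x; rewrite !inE.
    have [->|xu] := eqVneq x u; first by rewrite (negPf uW).
    have [->|xv] := eqVneq x v; first by rewrite (negPf vW).
    by case: (x \in W); case: (x \in T).
  exact.
rewrite Phi_symdiff //.
set p := (_ :\: _, _).
have pP : p \in Pairs V.
  rewrite inE; apply/existsP; exists u; apply/existsP; exists v.
  by rewrite !inE !eqxx orbT uv.
have := eq2 (enum_rank_in pP p).
by rewrite mulmx_Mmx_chi mxE enum_rankK_in // => /mod2_sign.
Qed.
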